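(* Let $F\colon\mathbf{Set}\to\mathbf{Set}$ be a functor with an evaluation function $ev_F$. The Kantorovich lifting of $F$ preserves isometries: if $f\colon(X,d_X)\to(Y,d_Y)$ is an isometry, i.e. $d_Y(f(x),f(x'))=d_X(x,x')$ for all $x,x'$, then $K^F_{d_Y}(Ff(t_1),Ff(t_2))=K^F_{d_X}(t_1,t_2)$ for all $t_1,t_2\in FX$.
   Context: Fix $\top\in(0,\infty]$; pseudometrics take values in $[0,\top]$ (with $a+\infty=\infty$). $d_e$ is the Euclidean distance on $[0,\top]$ (with $d_e(a,\infty)=\infty$ for $a\ne\infty$, $d_e(\infty,\infty)=0$). Isometries need not be surjective or injective. An evaluation function for $F$ is any $ev_F\colon F[0,\top]\to[0,\top]$; for $g\colon X\to[0,\top]$ put $\tilde Fg=ev_F\circ Fg$. Kantorovich distance: $K^F_d(t_1,t_2)=\sup\{d_e(\tilde Ff(t_1),\tilde Ff(t_2))\mid f\colon(X,d)\to([0,\top],d_e)\text{ nonexpansive}\}$, where nonexpansive means $d_e(f(x),f(x'))\le d(x,x')$. The Kantorovich lifting maps $(X,d)$ to $(FX,K^F_d)$ and $f$ to $Ff$. *)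

(* Defs.v *)
From mathcomp Require Import all_boot all_order all_algebra.
From mathcomp Require Import all_classical all_reals ereal.
Set Implicit Arguments.
Unset Strict Implicit.
Unset Printing Implicit Defensive.
Import Order.TTheory GRing.Theory Num.Theory.
Local Open Scope classical_set_scope.
Local Open Scope ring_scope.
Local Open Scope ereal_scope.

Definition segment (R : realType) (top : \bar R) : Type :=
  {a : \bar R | 0 <= a <= top}.

(* The sum in [dist_triangle] is that of [\bar R]: it is not truncated at
   [top]. *)
Record pseudometric (R : realType) (top : \bar R) (X : Type) := Pseudometric {
  dist :> X -> X -> segment top;
  dist_refl : forall x, val (dist x x) = 0;
  dist_sym : forall x y, dist x y = dist y x;
  dist_triangle : forall x y z,
    val (dist x z) <= val (dist x y) + val (dist y z) }.

Definition nonexpansive (R : realType) (top : \bar R) (X Y : Type)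
    (dX : pseudometric top X) (dY : pseudometric top Y) (f : X -> Y) : Prop :=
  forall x x', val (dY (f x) (f x')) <= val (dX x x').

Definition is_isometry (R : realType) (top : \bar R) (X Y : Type)
    (dX : pseudometric top X) (dY : pseudometric top Y) (f : X -> Y) : Prop :=
  forall x x', dY (f x) (f x') = dX x x'.

(* The test is needed because [+oo - +oo = -oo] in [\bar R]. *)
Definition euclid_val (R : realType) (a b : \bar R) : \bar R :=
  if a == b then 0 else `|a - b|.

Section Euclid.
Context (R : realType) (top : \bar R).
Implicit Types a b c : segment top.

Lemma euclid_val_bounds a b : 0 <= euclid_val (val a) (val b) <= top.
Proof.
rewrite /euclid_val; case: a b => [a /= /andP[a0 at_]] [b /= /andP[b0 bt]].
case: eqP => [_|ab]; first by rewrite lexx (le_trans a0).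
rewrite abse_ge0 /=.
case: a b a0 at_ b0 bt ab => [a||] [b||] // a0 at_ b0 bt _.
case: top at_ bt => [t||] // at_ bt; last by rewrite leey.
move: a0 b0 at_ bt; rewrite /= !lee_fin => a0 b0 at_ bt.
rewrite ler_norml lerBlDr (le_trans at_) ?lerDl// andbT.
by rewrite lerBrDl (le_trans _ a0)// subr_le0.
Qed.

Definition euclid_fun a b : segment top :=
  exist (fun c : \bar R => 0 <= c <= top) _ (euclid_val_bounds a b).

Lemma euclid_refl a : val (euclid_fun a a) = 0.
Proof. by rewrite /= /euclid_val eqxx. Qed.

Lemma euclid_sym a b : euclid_fun a b = euclid_fun b a.
Proof.
apply: val_inj => /=; rewrite /euclid_val eq_sym; case: eqP => // _.
case: a b => [[a||] //= _] [[b||] //= _].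
by rewrite distrC.
Qed.

Lemma euclid_triangle a b c :
  val (euclid_fun a c) <= val (euclid_fun a b) + val (euclid_fun b c).
Proof.
rewrite /= /euclid_val; case: a b c => [a /= _] [b /= _] [c /= _].
have [->|ab] := eqVneq a b; first by rewrite add0e.
have [<-|bc] := eqVneq b c; first by rewrite (negbTE ab) adde0.
case: ifP => _; first by rewrite adde_ge0 ?abse_ge0.
case: a b c ab bc => [a||] [b||] [c||] //= ab bc; rewrite ?leey//.
by rewrite lee_fin; exact: ler_distD.
Qed.

Definition euclid : pseudometric top (segment top) :=
  Pseudometric euclid_refl euclid_sym euclid_triangle.

End Euclid.
Arguments euclid {R top}.

(* The category of sets is rendered by types and functions. *)
Record set_functor := SetFunctor {
  functor_obj :> Type -> Type;
  functor_map : forall X Y : Type, (X -> Y) -> functor_obj X -> functor_obj Y;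
  functor_id : forall X : Type, functor_map (@id X) = id;
  functor_comp : forall (X Y Z : Type) (g : Y -> Z) (f : X -> Y),
    functor_map (g \o f) = functor_map g \o functor_map f }.
Arguments functor_map F {X Y} f t : rename.

Definition ev_lift (R : realType) (top : \bar R) (F : set_functor)
    (ev : F (segment top) -> segment top) (X : Type) (g : X -> segment top) :
  F X -> segment top := ev \o functor_map F g.

Section Kantorovich.
Context (R : realType) (top : \bar R) (F : set_functor).
Context (ev : F (segment top) -> segment top) (X : Type).
Context (d : pseudometric top X).

(* The supremum in [\bar R] is that of [0, top], because the set is nonempty
   (see [kantorovich_bounds]). *)
Definition kantorovich_val (t1 t2 : F X) : \bar R :=
  ereal_sup [set val (euclid (ev_lift ev f t1) (ev_lift ev f t2))
            | f in [set f : X -> segment top | nonexpansive d euclid f]].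

Lemma kantorovich_bounds t1 t2 : 0 <= kantorovich_val t1 t2 <= top.
Proof.
apply/andP; split; last first.
  by apply: ge_ereal_sup => _ [f _ <-]; case: (euclid _ _) => ? /= /andP[].
pose f x := d x x.
have ne : nonexpansive d euclid f.
  move=> x x'; have -> : f x = f x' by apply: val_inj; rewrite !dist_refl.
  by rewrite dist_refl; case: (d x x') => ? /= /andP[].
apply: (@le_trans _ _ (val (euclid (ev_lift ev f t1) (ev_lift ev f t2)))).
  by case: (euclid _ _) => ? /= /andP[].
by apply: ereal_sup_ubound; exists f.
Qed.

Definition kantorovich_fun t1 t2 : segment top :=
  exist (fun c : \bar R => 0 <= c <= top) _ (kantorovich_bounds t1 t2).

Lemma kantorovich_refl t : val (kantorovich_fun t t) = 0.
Proof.
apply/eqP; rewrite eq_le /=.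
have /andP[-> _] := kantorovich_bounds t t; rewrite andbT.
by apply: ge_ereal_sup => _ [f _ <-]; rewrite dist_refl.
Qed.

Lemma kantorovich_sym t1 t2 : kantorovich_fun t1 t2 = kantorovich_fun t2 t1.
Proof.
by apply: val_inj => /=; congr ereal_sup; apply/seteqP; split=> _ [f nf <-];
  exists f => //; rewrite dist_sym.
Qed.

Lemma kantorovich_triangle t1 t2 t3 :
  val (kantorovich_fun t1 t3)
  <= val (kantorovich_fun t1 t2) + val (kantorovich_fun t2 t3).
Proof.
apply: ge_ereal_sup => _ [f nf <-].
apply: le_trans (dist_triangle _ _ (ev_lift ev f t2) _) _.
by apply: leeD; apply: ereal_sup_ubound; exists f.
Qed.

Definition kantorovich : pseudometric top (F X) :=
  Pseudometric kantorovich_refl kantorovich_sym kantorovich_triangle.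

End Kantorovich.

(* Main.v *)
(* A nonexpansive [g] on [X] extends along the isometry [f] to [Y] by
   McShane's formula [h y = min (top, inf_x (g x + d_Y (f x, y)))].  Hence
   [h |-> h \o f] maps the nonexpansive functions on [Y] onto those on [X],
   and both suprema range over the same set. *)
Require Import Defs.
From mathcomp Require Import all_boot all_order all_algebra.
From mathcomp Require Import all_classical all_reals ereal.
Set Implicit Arguments.
Unset Strict Implicit.
Unset Printing Implicit Defensive.
Import Order.TTheory GRing.Theory Num.Theory.
Local Open Scope classical_set_scope.
Local Open Scope ereal_scope.

(** Trading the difference for two sums avoids [+oo - +oo]: the equivalence stays correct when any
    of the three values is [+oo]. *)
Lemma euclid_val_le (R : realType) (a b c : \bar R) :
  0 <= a -> 0 <= b -> 0 <= c ->
  (euclid_val a b <= c) = (a <= b + c) && (b <= a + c).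
Proof.
move=> a0 b0 c0; rewrite /euclid_val.
have [->|ab] := eqVneq a b; first by rewrite c0 leeDl.
case: a b c a0 b0 c0 ab => [a||] [b||] [c||] //= _ _ _ _; rewrite ?leey//.
by rewrite !lee_fin distrC ler_distlC lerBlDr andbC.
Qed.

Lemma segment_ge0 (R : realType) (top : \bar R) (a : segment top) :
  0 <= val a.
Proof. by case: a => a /= /andP[]. Qed.

Lemma segment_le (R : realType) (top : \bar R) (a : segment top) :
  val a <= top.
Proof. by case: a => a /= /andP[]. Qed.

(** One inequality suffices, since swapping [x] and [x'] yields the other by symmetry of [d]. *)
Lemma nonexpansive_euclidP (R : realType) (top : \bar R) (X : Type)
    (d : pseudometric top X) (g : X -> segment top) :
  nonexpansive d euclid g <->
  forall x x', val (g x) <= val (g x') + val (d x x').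
Proof.
split=> [ne x x'|le_g x x']; last first.
  rewrite /= euclid_val_le ?segment_ge0// le_g /=.
  by rewrite (dist_sym d) le_g.
by move: (ne x x'); rewrite /= euclid_val_le ?segment_ge0// => /andP[].
Qed.

Lemma nonexpansive_comp_isometry (R : realType) (top : \bar R) (X Y Z : Type)
    (dX : pseudometric top X) (dY : pseudometric top Y)
    (dZ : pseudometric top Z) (f : X -> Y) (h : Y -> Z) :
  is_isometry dX dY f -> nonexpansive dY dZ h -> nonexpansive dX dZ (h \o f).
Proof. by move=> isof ne x x'; rewrite -isof; exact: ne. Qed.

Section McShane.
Context (R : realType) (top : \bar R) (top_ge0 : 0 <= top) (X Y : Type).
Context (dY : pseudometric top Y) (f : X -> Y) (g : X -> segment top).

(** The infimum is taken in [\bar R]: it may exceed [top], and it is [+oo] when [X] is empty, whence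
    the truncation in [mcshane]. *)
Definition mcshane_inf (y : Y) : \bar R :=
  ereal_inf (range (fun x => val (g x) + val (dY (f x) y))).

Lemma mcshane_inf_ge0 y : 0 <= mcshane_inf y.
Proof.
by apply: le_ereal_inf_tmp => _ [x _ <-]; rewrite adde_ge0 ?segment_ge0.
Qed.

Lemma mcshane_inf_le y y' :
  mcshane_inf y <= mcshane_inf y' + val (dY y y').
Proof.
have d0 := segment_ge0 (dY y y').
case dE : (val (dY y y')) d0 => [r||] // _; last first.
  (* At infinite distance the right side is [+oo], because the infimum is not [-oo]. *)
  by rewrite addey ?leey// gt_eqF// (lt_le_trans _ (mcshane_inf_ge0 _)).
(* A finite distance can be moved to the left, so the infimum at [y'] is bounded term by term, with
   the same [x] used at [y]. *)
rewrite -leeBlDr//; apply: le_ereal_inf_tmp => _ [x _ <-].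
rewrite leeBlDr//; apply: (@le_trans _ _ (val (g x) + val (dY (f x) y))).
  by apply: ereal_inf_lbound; exists x.
by rewrite -addeA leeD2l// -dE (dist_sym dY y) dist_triangle.
Qed.

Lemma mcshane_bounds y : 0 <= mine top (mcshane_inf y) <= top.
Proof. by rewrite le_min top_ge0 mcshane_inf_ge0 ge_min lexx. Qed.

Definition mcshane (y : Y) : segment top :=
  exist (fun c : \bar R => 0 <= c <= top) _ (mcshane_bounds y).

Lemma mcshane_nonexpansive : nonexpansive dY euclid mcshane.
Proof.
apply/nonexpansive_euclidP => y y' /=.
(* If the value at [y'] is truncated to [top], it already dominates every value at [y]. *)
have [_|_] := leP top (mcshane_inf y').
  by rewrite ge_min leeDl ?segment_ge0.
by rewrite ge_min mcshane_inf_le orbT.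
Qed.

Lemma mcshane_extends (dX : pseudometric top X) :
  is_isometry dX dY f -> nonexpansive dX euclid g -> mcshane \o f = g.
Proof.
move=> isof /nonexpansive_euclidP le_g; apply/funext => x.
apply: val_inj => /=; apply/eqP; rewrite eq_le ge_min le_min segment_le /=.
apply/andP; split.
  (* The term of index [x] in the infimum at [f x] is [g x] itself. *)
  apply/orP; right; apply: ereal_inf_lbound; exists x => //.
  by rewrite dist_refl adde0.
(* Conversely, the isometry turns each term into [g x' + dX x' x], which nonexpansiveness bounds
   below by [g x]; injectivity of [f] is never at issue. *)
apply: le_ereal_inf_tmp => _ [x' _ <-].
by rewrite isof (dist_sym dX) le_g.
Qed.

End McShane.

Lemma ev_lift_map (R : realType) (top : \bar R) (F : set_functor)
    (ev : F (segment top) -> segment top) (X Y : Type) (f : X -> Y)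
    (h : Y -> segment top) (t : F X) :
  ev_lift ev h (functor_map F f t) = ev_lift ev (h \o f) t.
Proof. by rewrite /ev_lift functor_comp. Qed.

Theorem theorem5p8 (R : realType) (top : \bar R) (top_gt0 : 0 < top)
    (F : set_functor) (ev : F (segment top) -> segment top)
    (X Y : Type) (dX : pseudometric top X) (dY : pseudometric top Y)
    (f : X -> Y) :
  is_isometry dX dY f ->
  is_isometry (kantorovich ev dX) (kantorovich ev dY) (functor_map F f).
Proof.
move=> isof t1 t2; apply: val_inj => /=; congr ereal_sup.
apply/seteqP; split=> _ [h ne <-].
  exists (h \o f); first exact: nonexpansive_comp_isometry isof ne.
  by rewrite !ev_lift_map.
exists (mcshane (ltW top_gt0) dY f h); first exact: mcshane_nonexpansive.
by rewrite !ev_lift_map (mcshane_extends _ isof ne).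
Qed.
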